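(* Let $c>0$ and $a,b,d,f>0$, and let $\tilde{x}_1=(0,0,0)$, $\tilde{x}_2=(a,0,0)$, $\tilde{x}_3=(-b,0,0)$, $\tilde{x}_4=(0,d,0)$, $\tilde{x}_5=(0,0,f)$ in $\mathbb{R}^3$. Let $s^*\in\mathbb{R}^3\setminus\{\tilde{x}_1,\dots,\tilde{x}_5\}$ be the source position, and let $\Delta t_{i1}=c^{-1}(|s^*-\tilde{x}_i|-|s^*-\tilde{x}_1|)$, $i=2,3,4,5$, be the corresponding time differences of arrival. Let $\Omega=[x_{\min},x_{\max}]\times[y_{\min},y_{\max}]\times[z_{\min},z_{\max}]\subset\mathbb{R}^3$ be a bounded closed box. For $\tilde{y}\in\Omega$ define $$I_{i1}(\tilde{y})=\big|\,|\tilde{y}-\tilde{x}_i|-|\tilde{y}-\tilde{x}_1|-c\,\Delta t_{i1}\big|,\qquad I(\tilde{y})=\big[I_{21}(\tilde{y})+I_{31}(\tilde{y})+I_{41}(\tilde{y})+I_{51}(\tilde{y})\big]^{-1}.$$ Then for every $\tilde{y}\in\Omega$: $I(\tilde{y})=+\infty$ if $\tilde{y}=s^*$, and $I(\tilde{y})$ is a finite positive number if $\tilde{y}\neq s^*$.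
   Context: $|\cdot|$ is the Euclidean norm on $\mathbb{R}^3$ and $c$ is the constant wave speed. The convention $0^{-1}=+\infty$ is used, so $I$ takes values in $(0,+\infty]$. Source positions never coincide with observation points. *)

(* Defs.v *)
From HB Require Import structures.
From mathcomp Require Import all_boot all_order all_algebra.
From mathcomp Require Import all_classical all_reals.

Set Implicit Arguments.
Unset Strict Implicit.
Unset Printing Implicit Defensive.

Import Order.TTheory GRing.Theory Num.Theory.

Local Open Scope classical_set_scope.
Local Open Scope ring_scope.

Definition vec3 {R : realType} (x y z : R) : 'rV[R]_3 :=
  \row_(j < 3) [:: x; y; z]`_j.

(* The canonical norm of MathComp-Analysis on 'rV[R]_n is the sup norm, hence
   this definition of the Euclidean one. *)
Definition enorm {R : realType} (n : nat) (v : 'rV[R]_n) : R :=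
  Num.sqrt (\sum_(j < n) v 0 j ^+ 2).

Definition box3 {R : realType} (xmin xmax ymin ymax zmin zmax : R) :
    set 'rV[R]_3 :=
  [set y | [/\ y 0 0 \in `[xmin, xmax], y 0 1 \in `[ymin, ymax]
             & y 0 2 \in `[zmin, zmax]]].

Definition tdoa {R : realType} (c : R) (s xi x1 : 'rV[R]_3) : R :=
  c^-1 * (enorm (s - xi) - enorm (s - x1)).

Definition misfit {R : realType} (c : R) (xi x1 : 'rV[R]_3) (dt : R)
    (y : 'rV[R]_3) : R :=
  `| enorm (y - xi) - enorm (y - x1) - c * dt |.

(* The inverse is taken in \bar R, where 0^-1 = +oo and r%:E^-1 = (r^-1)%:E
   for r != 0. *)
Definition indicator {R : realType} (c : R) (x1 x2 x3 x4 x5 : 'rV[R]_3)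
    (dt2 dt3 dt4 dt5 : R) (y : 'rV[R]_3) : \bar R :=
  ((misfit c x2 x1 dt2 y + misfit c x3 x1 dt3 y
    + misfit c x4 x1 dt4 y + misfit c x5 x1 dt5 y)%:E^-1)%E.

(* Main.v *)
Require Import Defs.
From HB Require Import structures.
From mathcomp Require Import all_boot all_order all_algebra.
From mathcomp Require Import all_classical all_reals.
From mathcomp Require Import ring lra.

Set Implicit Arguments.
Unset Strict Implicit.
Unset Printing Implicit Defensive.

Import Order.TTheory GRing.Theory Num.Theory.

Local Open Scope classical_set_scope.
Local Open Scope ring_scope.

(** The indicator is the inverse of a sum of nonnegative misfits that vanishes
    at [s], so everything reduces to uniqueness: a point [y] with the same range
    differences [|y - x_i| - |y|] as [s] must be [s].

    Let [g_i] be the common range difference for a sensor at [h e_i].  Squaring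
    [|y - h e_i| = |y| + g_i], doing the same for [s] and subtracting gives
    [h (y_i - s_i) = (|s| - |y|) g_i] ([range_diff_coord]).  If [|y| = |s|], the
    sensors on the axes give [y = s] one coordinate at a time.  Otherwise the
    two sensors [a e_j], [a' e_j] sharing the axis of [e_j] with the origin
    give the same slope [k = g / a = g' / a'], so the graph of
    [t |-> |v - t e_j|], for [v = s] and [v = y], has three collinear points, at
    [0], [a] and [a'].  This function is strictly convex unless [v] lies on the
    axis, hence [s] and [y] lie on it ([on_axis_of_range_slope]).  So [y_i = s_i = 0] for any other axis [i], and
    the relation above forces [g_i = 0]: [s] is equidistant from the origin and
    [h e_i], that is [s_i = h / 2 <> 0], a contradiction
    ([eq_of_range_diffs]). *)

Section RangeDifferences.
Variables (R : realType) (n : nat).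
Implicit Types (v s y : 'rV[R]_n) (i j : 'I_n).

Lemma enorm_sqr v : enorm v ^+ 2 = \sum_(i < n) v 0 i ^+ 2.
Proof. by rewrite sqr_sqrtr // sumr_ge0 // => i _; rewrite sqr_ge0. Qed.

Lemma enorm_sqrB_axis v h j :
  enorm (v - h *: delta_mx 0 j) ^+ 2
  = enorm v ^+ 2 - 2 * h * v 0 j + h ^+ 2.
Proof.
rewrite !enorm_sqr (bigD1 j) //= [in RHS](bigD1 j) //= !mxE !eqxx /=.
rewrite (eq_bigr (fun i => v 0 i ^+ 2)); first by ring.
by move=> i /negPf ij; rewrite !mxE ij andbF mulr0 subr0.
Qed.

(** The quadratic terms [|v|^2] cancel on both sides of the squared range
    equation, which leaves a relation linear in the coordinate and the norm. *)
Lemma range_diff_sqr v h j g :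
  enorm (v - h *: delta_mx 0 j) - enorm v = g ->
  h ^+ 2 - 2 * h * v 0 j = 2 * enorm v * g + g ^+ 2.
Proof.
move=> /eqP; rewrite subr_eq => /eqP e.
by have := enorm_sqrB_axis v h j; rewrite e => ?; lra.
Qed.

Lemma range_diff_coord s y h j g :
  enorm (s - h *: delta_mx 0 j) - enorm s = g ->
  enorm (y - h *: delta_mx 0 j) - enorm y = g ->
  h * (y 0 j - s 0 j) = (enorm s - enorm y) * g.
Proof. by move=> /range_diff_sqr es /range_diff_sqr ey; lra. Qed.

(** Dividing the squared range equation by [a] and by [a'] and subtracting
    leaves [a - a' = (a - a') k^2], so [k] is a sign and [v_j = - k |v|]; then
    the [j]-th coordinate already accounts for the whole norm of [v]. *)
Lemma on_axis_of_range_slope v a a' j k :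
  a != 0 -> a' != 0 -> a != a' ->
  enorm (v - a *: delta_mx 0 j) - enorm v = a * k ->
  enorm (v - a' *: delta_mx 0 j) - enorm v = a' * k ->
  forall i, i != j -> v 0 i = 0.
Proof.
move=> a0 a'0 aa' /range_diff_sqr e /range_diff_sqr e' i ij.
have e1 : a - 2 * v 0 j = 2 * enorm v * k + a * k ^+ 2.
  by apply: (mulfI a0); lra.
have e1' : a' - 2 * v 0 j = 2 * enorm v * k + a' * k ^+ 2.
  by apply: (mulfI a'0); lra.
have k1 : k ^+ 2 = 1.
  have aa0 : a - a' != 0 by rewrite subr_eq0.
  by apply: (mulfI aa0); lra.
have vj : v 0 j = - (enorm v * k) by move: e1; rewrite k1 => ?; lra.
have := enorm_sqr v; rewrite (bigD1 j) //= vj sqrrN exprMn k1 mulr1.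
move=> /eqP; rewrite addrC -subr_eq subrr eq_sym => /eqP /psumr_eq0P v0.
by apply/eqP; rewrite -sqrf_eq0 v0 // => l _; rewrite sqr_ge0.
Qed.

(** Sensors on the axis of [e_j] alone cannot separate the points of that axis
    beyond the outermost sensor, which all have the same range differences; the
    sensor on a second axis [i] does, because no point of the axis of [e_j] is
    equidistant from it and from the origin. *)
Lemma eq_of_range_diffs (h : 'I_n -> R) a' i j s y :
  (forall l, h l != 0) -> a' != 0 -> h j != a' -> i != j ->
  (forall l, enorm (y - h l *: delta_mx 0 l) - enorm y
             = enorm (s - h l *: delta_mx 0 l) - enorm s) ->
  enorm (y - a' *: delta_mx 0 j) - enorm y
    = enorm (s - a' *: delta_mx 0 j) - enorm s ->
  y = s.
Proof.
move=> h0 a'0 ha' ij eh ea'.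
have coord l := range_diff_coord erefl (eh l).
have coord' := range_diff_coord erefl ea'.
have [r_eq|r_neq] := eqVneq (enorm s) (enorm y).
  apply/rowP => l; apply/eqP; rewrite -subr_eq0.
  by have /eqP := coord l; rewrite r_eq subrr mul0r mulf_eq0 (negPf (h0 l)).
have r0 : enorm s - enorm y != 0 by rewrite subr_eq0.
pose k := (y 0 j - s 0 j) / (enorm s - enorm y).
have sk : enorm (s - h j *: delta_mx 0 j) - enorm s = h j * k.
  by apply: (mulfI r0); rewrite -coord /k; field.
have sk' : enorm (s - a' *: delta_mx 0 j) - enorm s = a' * k.
  by apply: (mulfI r0); rewrite -coord' /k; field.
have si : s 0 i = 0 by apply: (on_axis_of_range_slope _ _ _ sk sk').
have yi : y 0 i = 0.
  by apply: (on_axis_of_range_slope (h0 j) a'0 ha' (k := k) _ _ ij);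
    rewrite ?eh ?ea'.
have g0 : enorm (s - h i *: delta_mx 0 i) - enorm s = 0.
  by apply: (mulfI r0); rewrite -coord si yi subrr !mulr0.
have /eqP := range_diff_sqr g0.
by rewrite si !mulr0 subr0 expr0n addr0 sqrf_eq0 (negPf (h0 i)).
Qed.

End RangeDifferences.

Section Vec3.
Variable R : realType.
Implicit Types h : R.

Lemma vec3_axis0 h : vec3 h 0 0 = h *: delta_mx 0 0.
Proof.
by apply/rowP => -[[|[|[|//]]] p]; rewrite !mxE /= ?mulr1 ?mulr0.
Qed.

Lemma vec3_axis1 h : vec3 0 h 0 = h *: delta_mx 0 1.
Proof.
by apply/rowP => -[[|[|[|//]]] p]; rewrite !mxE /= ?mulr1 ?mulr0.
Qed.

Lemma vec3_axis2 h : vec3 0 0 h = h *: delta_mx 0 2.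
Proof.
by apply/rowP => -[[|[|[|//]]] p]; rewrite !mxE /= ?mulr1 ?mulr0.
Qed.

End Vec3.

Section Misfit.
Variable R : realType.
Implicit Types (c : R) (s x y : 'rV[R]_3).

Lemma misfit_tdoa c x s y : c != 0 ->
  misfit c x 0 (tdoa c s x 0) y
  = `| (enorm (y - x) - enorm y) - (enorm (s - x) - enorm s) |.
Proof. by move=> c0; rewrite /misfit /tdoa !subr0 mulVKf. Qed.

Lemma misfit_tdoa_eq0 c x s y : c != 0 ->
  misfit c x 0 (tdoa c s x 0) y = 0 ->
  enorm (y - x) - enorm y = enorm (s - x) - enorm s.
Proof.
by move=> c0; rewrite misfit_tdoa // => /normr0_eq0 /eqP; rewrite subr_eq0 => /eqP.
Qed.

End Misfit.

Theorem theorem3p2 (R : realType) (c a b d f : R)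
    (hc : 0 < c) (ha : 0 < a) (hb : 0 < b) (hd : 0 < d) (hf : 0 < f)
    (xmin xmax ymin ymax zmin zmax : R) (s : 'rV[R]_3) :
  let x1 := vec3 0 0 0 in
  let x2 := vec3 a 0 0 in
  let x3 := vec3 (- b) 0 0 in
  let x4 := vec3 0 d 0 in
  let x5 := vec3 0 0 f in
  let I := indicator c x1 x2 x3 x4 x5
             (tdoa c s x2 x1) (tdoa c s x3 x1)
             (tdoa c s x4 x1) (tdoa c s x5 x1) in
  s \notin [:: x1; x2; x3; x4; x5] ->
  forall y : 'rV[R]_3, box3 xmin xmax ymin ymax zmin zmax y ->
    (y = s -> I y = +oo%E) /\ (y <> s -> (0 < I y < +oo)%E).
Proof.
move=> x1 x2 x3 x4 x5 I _ y _.
have c0 : c != 0 by rewrite gt_eqF.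
have x10 : x1 = 0 by rewrite /x1 vec3_axis0 scale0r.
rewrite /I /indicator x10; split=> [->|ys].
  by rewrite !misfit_tdoa // !subrr normr0 !addr0 inve0.
set M := (X in (X%:E^-1)%E).
have m_ge0 x : 0 <= misfit c x 0 (tdoa c s x 0) y by apply: normr_ge0.
have M_gt0 : 0 < M.
  rewrite lt_neqAle eq_sym andbC !addr_ge0 //=; apply/eqP => M0.
  have [m2 m3 m4 m5] := And4 (m_ge0 x2) (m_ge0 x3) (m_ge0 x4) (m_ge0 x5).
  have e2 : misfit c x2 0 (tdoa c s x2 0) y = 0 by rewrite /M in M0; lra.
  have e3 : misfit c x3 0 (tdoa c s x3 0) y = 0 by rewrite /M in M0; lra.
  have e4 : misfit c x4 0 (tdoa c s x4 0) y = 0 by rewrite /M in M0; lra.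
  have e5 : misfit c x5 0 (tdoa c s x5 0) y = 0 by rewrite /M in M0; lra.
  apply: ys.
  apply: (@eq_of_range_diffs _ _ (fun l => [:: a; d; f]`_l) (- b) 1 0).
  - by move=> [[|[|[|//]]] p] /=; rewrite gt_eqF.
  - by rewrite oppr_eq0 gt_eqF.
  - by rewrite /= gt_eqF //; lra.
  - by [].
  - move=> l; have [->|->|->] : [\/ l = 0, l = 1 | l = 2].
      by case: l => [[|[|[|//]]] p]; [apply: Or31|apply: Or32|apply: Or33];
        apply: val_inj.
    + by rewrite /= -vec3_axis0; apply: misfit_tdoa_eq0 c0 e2.
    + by rewrite /= -vec3_axis1; apply: misfit_tdoa_eq0 c0 e4.
    + by rewrite /= -vec3_axis2; apply: misfit_tdoa_eq0 c0 e5.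
  - by rewrite -vec3_axis0; apply: misfit_tdoa_eq0 c0 e3.
by rewrite inver gt_eqF // lte_fin invr_gt0 M_gt0 ltry.
Qed.
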